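(* Let $\vdash\sigma_1:\Xi\Rightarrow\Xi'$ and $\vdash\sigma_2:\Xi\Rightarrow\Xi'$ be valid substitutions and let $Y$ be a coercion family with $\Xi'\vdash Y:\sigma_1\le_F\sigma_2$. For every value type $\Xi\vdash A:S$ with $\mathtt{fp}(A)\subseteq F$ and every computation type $\Xi\vdash C:S$ with $\mathtt{fp}(C)\subseteq F$, we have $$\Xi'\vdash Y(A):\sigma_1(A)\le\sigma_2(A)\qquad\text{and}\qquad\Xi'\vdash Y(C):\sigma_1(C)\le\sigma_2(C).$$
   Context: SYNTAX. Fix a global signature $\Sigma$: a finite set of operations $op$. There are parameters of five kinds: skeleton $\varsigma$, dirt $\delta$, type $\alpha$, dirt coercion $\varpi$, type coercion $\omega$. Skeletons: $S::=\varsigma\mid\mathtt{Unit}\mid S_1\to S_2$. Dirts: $\Delta::=\delta\mid\emptyset\mid\{op\}\cup\Delta$, considered up to reordering and repetition of operations, so each dirt is $O$ or $O\cup\delta$ with $O$ a finite set of operations. Value types: $A::=\alpha\mid\mathtt{Unit}\mid A\to C$; computation types: $C::=A\,!\,\Delta$. A (parameter) context $\Xi$ is a finite list of distinct parameters: $\varsigma$; $\delta$; $\alpha:S$; $\varpi:\Delta_1\le\Delta_2$; $\omega:A_1\le A_2$. $\Xi\vdash S\ \mathtt{skel}$ (resp. $\Xi\vdash\Delta\ \mathtt{dirt}$) means all parameters of $S$ (resp. $\Delta$) are in $\Xi$ and all operations in $\Delta$ are in $\Sigma$. $\Xi\vdash A:S$ and $\Xi\vdash C:S$ (with $\Xi\vdash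 S\ \mathtt{skel}$) are given by: $\alpha:S$ if $(\alpha:S)\in\Xi$; $\mathtt{Unit}:\mathtt{Unit}$; $A\to C:S_1\to S_2$ if $A:S_1$, $C:S_2$; $A\,!\,\Delta:S$ if $A:S$ and $\Xi\vdash\Delta\ \mathtt{dirt}$. $\Xi$ is well-formed if all skeletons and dirts occurring in it are well-formed in $\Xi$ and for each $\omega:A_1\le A_2$ in $\Xi$ both $A_i$ have a common skeleton in $\Xi$. All contexts are assumed well-formed. COERCIONS. Dirt coercions $\gamma_d::=\varpi\mid\gamma_d^2\circ\gamma_d^1\mid\langle\delta\rangle\mid\langle\emptyset\rangle\mid\emptyset_\delta\mid\{op\}\cup\gamma_d\mid\{op\}\cup^+\gamma_d$; value coercions $\gamma_v::=\omega\mid\gamma_v^2\circ\gamma_v^1\mid\langle\alpha\rangle\mid\langle\mathtt{Unit}\rangle\mid\gamma_v\to\gamma_c$; computation coercions $\gamma_c::=\gamma_v\,!\,\gamma_d$. Rules in context $\Xi$ (both sides are presupposed well-formed, and for types of the same skeleton): $\varpi,\omega$ have the inequality declared in $\Xi$; $\gamma^2\circ\gamma^1:X\le Z$ if $\gamma^1:X\le Y$, $\gamma^2:Y\le Z$; $\langle\delta\rangle:\delta\le\delta$; $\langle\emptyset\rangle:\emptyset\le\emptyset$; $\emptyset_\delta:\emptyset\le\delta$; if $\gamma_d:\Delta\le\Delta'$ then $\{op\}\cup\gamma_d:\{op\}\cup\Delta\le\{op\}\cup\Delta'$ and $\{op\}\cup^+\gamma_d:\Delta\le\{op\}\cup\Delta'$;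 $\langle\alpha\rangle:\alpha\le\alpha$; $\langle\mathtt{Unit}\rangle:\mathtt{Unit}\le\mathtt{Unit}$; $\gamma_v\to\gamma_c:(A\to C)\le(A'\to C')$ if $\gamma_v:A'\le A$, $\gamma_c:C\le C'$; $\gamma_v\,!\,\gamma_d:(A\,!\,\Delta)\le(A'\,!\,\Delta')$ if $\gamma_v:A\le A'$, $\gamma_d:\Delta\le\Delta'$. SUBSTITUTIONS. A valid substitution $\vdash\sigma:\Xi\Rightarrow\Xi'$ assigns to every parameter of $\Xi$: to $\varsigma$ a skeleton with $\Xi'\vdash\sigma(\varsigma)\ \mathtt{skel}$; to $\delta$ a dirt with $\Xi'\vdash\sigma(\delta)\ \mathtt{dirt}$; to $\alpha:S$ a value type with $\Xi'\vdash\sigma(\alpha):\sigma(S)$; to $\varpi:\Delta_1\le\Delta_2$ a coercion $\Xi'\vdash\sigma(\varpi):\sigma(\Delta_1)\le\sigma(\Delta_2)$; to $\omega:A_1\le A_2$ a coercion $\Xi'\vdash\sigma(\omega):\sigma(A_1)\le\sigma(A_2)$. It acts homomorphically on skeletons, dirts and types. POLARITY. Free parameters are pairs of sets $F=(F^+,F^-)$ of type and dirt parameters; set operations and inclusion are componentwise and $\overline{(F^+,F^-)}=(F^-,F^+)$. $\mathtt{fp}(\alpha)=(\{\alpha\},\emptyset)$, $\mathtt{fp}(\delta)=(\{\delta\},\emptyset)$, $\mathtt{fp}(\mathtt{Unit})=\mathtt{fp}(\emptyset)=(\emptyset,\emptyset)$, $\mathtt{fp}(A\to C)=\overline{\mathtt{fp}(A)}\cup\mathtt{fp}(C)$,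 $\mathtt{fp}(\{op\}\cup\Delta)=\mathtt{fp}(\Delta)$, $\mathtt{fp}(A\,!\,\Delta)=\mathtt{fp}(A)\cup\mathtt{fp}(\Delta)$. COERCION FAMILIES. A coercion family $Y$ assigns a value coercion $Y(\alpha)$ to each type parameter and a dirt coercion $Y(\delta)$ to each dirt parameter. For $\vdash\sigma_1,\sigma_2:\Xi\Rightarrow\Xi'$, $\Xi'\vdash Y:\sigma_1\le_F\sigma_2$ means: for each type or dirt parameter $p\in F^+$, $\Xi'\vdash Y(p):\sigma_1(p)\le\sigma_2(p)$, and for each $p\in F^-$, $\Xi'\vdash Y(p):\sigma_2(p)\le\sigma_1(p)$. $Y$ extends structurally: $Y(\emptyset)=\langle\emptyset\rangle$, $Y(\{op\}\cup\Delta)=\{op\}\cup Y(\Delta)$, $Y(\mathtt{Unit})=\langle\mathtt{Unit}\rangle$, $Y(A\to C)=Y(A)\to Y(C)$, $Y(A\,!\,\Delta)=Y(A)\,!\,Y(\Delta)$. *)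

(* Defs.v *)
From mathcomp Require Import all_boot.
From mathcomp Require Import finmap.
From mathcomp Require Import classical_sets.
From Stdlib Require List.

Set Implicit Arguments.
Unset Strict Implicit.
Unset Printing Implicit Defensive.

(* The five kinds of parameters; all names are drawn from a countable supply
   and the kind is determined by the syntactic position. *)
Definition skel_param := nat.
Definition dirt_param := nat.
Definition type_param := nat.
Definition dirt_co_param := nat.
Definition type_co_param := nat.

Inductive param : Type :=
| PSkel of skel_param
| PDirt of dirt_param
| PType of type_param
| PDirtCo of dirt_co_param
| PTypeCo of type_co_param.

Inductive skel : Type :=
| SVar of skel_param
| SUnit
| SArr of skel & skel.

(* Raw dirts; the identification up to reordering and repetition of operations
   is [dirt_eqv] below, and the coercion judgements are closed under it. *)
Inductive dirt (Op : Type) : Type :=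
| DVar of dirt_param
| DEmpty
| DOp of Op & dirt Op.
Arguments DVar {Op}.
Arguments DEmpty {Op}.

Inductive vty (Op : Type) : Type :=
| TVar of type_param
| TUnit
| TArr of vty Op & cty Op
with cty (Op : Type) : Type :=
| TComp of vty Op & dirt Op.
Arguments TVar {Op}.
Arguments TUnit {Op}.

Inductive entry (Op : Type) : Type :=
| ESkel of skel_param
| EDirt of dirt_param
| EType of type_param & skel
| EDirtCo of dirt_co_param & dirt Op & dirt Op
| ETypeCo of type_co_param & vty Op & vty Op.
Arguments ESkel {Op}.
Arguments EDirt {Op}.
Arguments EType {Op}.

Definition ctx (Op : Type) : Type := seq (entry Op).

Definition entry_param (Op : Type) (e : entry Op) : param :=
  match e with
  | ESkel s => PSkel s
  | EDirt d => PDirt d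
  | EType a _ => PType a
  | EDirtCo w _ _ => PDirtCo w
  | ETypeCo w _ _ => PTypeCo w
  end.

Inductive dirt_eqv (Op : Type) : dirt Op -> dirt Op -> Prop :=
| dirt_eqv_refl D : dirt_eqv D D
| dirt_eqv_sym D1 D2 : dirt_eqv D1 D2 -> dirt_eqv D2 D1
| dirt_eqv_trans D1 D2 D3 :
    dirt_eqv D1 D2 -> dirt_eqv D2 D3 -> dirt_eqv D1 D3
| dirt_eqv_op op D1 D2 : dirt_eqv D1 D2 -> dirt_eqv (DOp op D1) (DOp op D2)
| dirt_eqv_swap op1 op2 D :
    dirt_eqv (DOp op1 (DOp op2 D)) (DOp op2 (DOp op1 D))
| dirt_eqv_dup op D : dirt_eqv (DOp op (DOp op D)) (DOp op D).

Inductive vty_eqv (Op : Type) : vty Op -> vty Op -> Prop :=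
| vty_eqv_var a : vty_eqv (TVar a) (TVar a)
| vty_eqv_unit : vty_eqv TUnit TUnit
| vty_eqv_arr A C A' C' :
    vty_eqv A A' -> cty_eqv C C' -> vty_eqv (TArr A C) (TArr A' C')
with cty_eqv (Op : Type) : cty Op -> cty Op -> Prop :=
| cty_eqv_comp A D A' D' :
    vty_eqv A A' -> dirt_eqv D D' -> cty_eqv (TComp A D) (TComp A' D').

Fixpoint skel_wf (Op : Type) (Xi : ctx Op) (Sk : skel) : Prop :=
  match Sk with
  | SVar s => List.In (ESkel s) Xi
  | SUnit => True
  | SArr Sk1 Sk2 => skel_wf Xi Sk1 /\ skel_wf Xi Sk2
  end.

Fixpoint dirt_wf (Op : choiceType) (Sigma : {fset Op}) (Xi : ctx Op)
    (D : dirt Op) : Prop :=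
  match D with
  | DVar d => List.In (EDirt d) Xi
  | DEmpty => True
  | DOp op D => op \in Sigma /\ dirt_wf Sigma Xi D
  end.

Inductive vty_skel (Op : choiceType) (Sigma : {fset Op}) (Xi : ctx Op) :
    vty Op -> skel -> Prop :=
| vty_skel_var a Sk :
    List.In (EType a Sk) Xi -> skel_wf Xi Sk -> vty_skel Sigma Xi (TVar a) Sk
| vty_skel_unit : vty_skel Sigma Xi TUnit SUnit
| vty_skel_arr A C Sk1 Sk2 :
    vty_skel Sigma Xi A Sk1 -> cty_skel Sigma Xi C Sk2 ->
    vty_skel Sigma Xi (TArr A C) (SArr Sk1 Sk2)
with cty_skel (Op : choiceType) (Sigma : {fset Op}) (Xi : ctx Op) :
    cty Op -> skel -> Prop :=
| cty_skel_comp A D Sk :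
    vty_skel Sigma Xi A Sk -> dirt_wf Sigma Xi D ->
    cty_skel Sigma Xi (TComp A D) Sk.

(* Scoping is with respect to the whole context, not to a prefix of it. *)
Definition entry_wf (Op : choiceType) (Sigma : {fset Op}) (Xi : ctx Op)
    (e : entry Op) : Prop :=
  match e with
  | ESkel _ | EDirt _ => True
  | EType _ Sk => skel_wf Xi Sk
  | EDirtCo _ D1 D2 => dirt_wf Sigma Xi D1 /\ dirt_wf Sigma Xi D2
  | ETypeCo _ A1 A2 =>
      exists Sk, vty_skel Sigma Xi A1 Sk /\ vty_skel Sigma Xi A2 Sk
  end.

Definition ctx_wf (Op : choiceType) (Sigma : {fset Op}) (Xi : ctx Op) : Prop :=
  List.NoDup (map (@entry_param Op) Xi) /\
  (forall e, List.In e Xi -> entry_wf Sigma Xi e).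

Inductive dco (Op : Type) : Type :=
| DCVar of dirt_co_param
| DCTrans of dco Op & dco Op        (* [DCTrans g2 g1] is g2 \o g1 *)
| DCReflVar of dirt_param
| DCReflEmpty
| DCFromEmpty of dirt_param
| DCOp of Op & dco Op               (* {op} \cup g *)
| DCOpR of Op & dco Op.             (* {op} \cup^+ g *)
Arguments DCVar {Op}.
Arguments DCReflVar {Op}.
Arguments DCReflEmpty {Op}.
Arguments DCFromEmpty {Op}.

Inductive vco (Op : Type) : Type :=
| VCVar of type_co_param
| VCTrans of vco Op & vco Op        (* [VCTrans g2 g1] is g2 \o g1 *)
| VCReflVar of type_param
| VCReflUnit
| VCArr of vco Op & cco Op
with cco (Op : Type) : Type :=
| CComp of vco Op & dco Op.
Arguments VCVar {Op}.
Arguments VCReflVar {Op}.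
Arguments VCReflUnit {Op}.

(* In a well-formed context, the premises on the leaves and on the operations
   make both sides of every derivable judgement well-formed, and the two sides
   of an inequality between types have a common skeleton. *)
Inductive dco_le (Op : choiceType) (Sigma : {fset Op}) (Xi : ctx Op) :
    dco Op -> dirt Op -> dirt Op -> Prop :=
| dco_le_var w D1 D2 :
    List.In (EDirtCo w D1 D2) Xi ->
    dirt_wf Sigma Xi D1 -> dirt_wf Sigma Xi D2 ->
    dco_le Sigma Xi (DCVar w) D1 D2
| dco_le_trans g2 g1 D1 D2 D3 :
    dco_le Sigma Xi g1 D1 D2 -> dco_le Sigma Xi g2 D2 D3 ->
    dco_le Sigma Xi (DCTrans g2 g1) D1 D3
| dco_le_refl_var d :
    dirt_wf Sigma Xi (DVar d) ->
    dco_le Sigma Xi (DCReflVar d) (DVar d) (DVar d)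
| dco_le_refl_empty : dco_le Sigma Xi DCReflEmpty DEmpty DEmpty
| dco_le_from_empty d :
    dirt_wf Sigma Xi (DVar d) ->
    dco_le Sigma Xi (DCFromEmpty d) DEmpty (DVar d)
| dco_le_op op g D D' :
    op \in Sigma -> dco_le Sigma Xi g D D' ->
    dco_le Sigma Xi (DCOp op g) (DOp op D) (DOp op D')
| dco_le_opr op g D D' :
    op \in Sigma -> dco_le Sigma Xi g D D' ->
    dco_le Sigma Xi (DCOpR op g) D (DOp op D')
| dco_le_eqv g D1 D2 D1' D2' :
    dirt_eqv D1 D1' -> dirt_eqv D2 D2' ->
    dco_le Sigma Xi g D1 D2 -> dco_le Sigma Xi g D1' D2'.

(* Closure of [cco_le] under [cty_eqv] follows from that of [vco_le] and
   [dco_le]. *)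
Inductive vco_le (Op : choiceType) (Sigma : {fset Op}) (Xi : ctx Op) :
    vco Op -> vty Op -> vty Op -> Prop :=
| vco_le_var w A1 A2 Sk :
    List.In (ETypeCo w A1 A2) Xi ->
    vty_skel Sigma Xi A1 Sk -> vty_skel Sigma Xi A2 Sk ->
    vco_le Sigma Xi (VCVar w) A1 A2
| vco_le_trans g2 g1 A1 A2 A3 :
    vco_le Sigma Xi g1 A1 A2 -> vco_le Sigma Xi g2 A2 A3 ->
    vco_le Sigma Xi (VCTrans g2 g1) A1 A3
| vco_le_refl_var a Sk :
    vty_skel Sigma Xi (TVar a) Sk ->
    vco_le Sigma Xi (VCReflVar a) (TVar a) (TVar a)
| vco_le_refl_unit : vco_le Sigma Xi VCReflUnit TUnit TUnit
| vco_le_arr gv gc A A' C C' :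
    vco_le Sigma Xi gv A' A -> cco_le Sigma Xi gc C C' ->
    vco_le Sigma Xi (VCArr gv gc) (TArr A C) (TArr A' C')
| vco_le_eqv g A1 A2 A1' A2' :
    vty_eqv A1 A1' -> vty_eqv A2 A2' ->
    vco_le Sigma Xi g A1 A2 -> vco_le Sigma Xi g A1' A2'
with cco_le (Op : choiceType) (Sigma : {fset Op}) (Xi : ctx Op) :
    cco Op -> cty Op -> cty Op -> Prop :=
| cco_le_comp gv gd A A' D D' :
    vco_le Sigma Xi gv A A' -> dco_le Sigma Xi gd D D' ->
    cco_le Sigma Xi (CComp gv gd) (TComp A D) (TComp A' D').

(* Substitutions are total functions on names; only their values on the
   parameters declared in the source context are constrained. *)
Record subst (Op : Type) : Type := Subst {
  sub_skel_param : skel_param -> skel;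
  sub_dirt_param : dirt_param -> dirt Op;
  sub_type_param : type_param -> vty Op;
  sub_dirt_co_param : dirt_co_param -> dco Op;
  sub_type_co_param : type_co_param -> vco Op }.

Fixpoint sub_skel (Op : Type) (s : subst Op) (Sk : skel) : skel :=
  match Sk with
  | SVar x => sub_skel_param s x
  | SUnit => SUnit
  | SArr Sk1 Sk2 => SArr (sub_skel s Sk1) (sub_skel s Sk2)
  end.

Fixpoint sub_dirt (Op : Type) (s : subst Op) (D : dirt Op) : dirt Op :=
  match D with
  | DVar d => sub_dirt_param s d
  | DEmpty => DEmpty
  | DOp op D => DOp op (sub_dirt s D)
  end.

Fixpoint sub_vty (Op : Type) (s : subst Op) (A : vty Op) : vty Op :=
  match A with
  | TVar a => sub_type_param s a
  | TUnit => TUnit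
  | TArr A C => TArr (sub_vty s A) (sub_cty s C)
  end
with sub_cty (Op : Type) (s : subst Op) (C : cty Op) : cty Op :=
  match C with
  | TComp A D => TComp (sub_vty s A) (sub_dirt s D)
  end.

Definition subst_entry_valid (Op : choiceType) (Sigma : {fset Op})
    (Xi' : ctx Op) (s : subst Op) (e : entry Op) : Prop :=
  match e with
  | ESkel x => skel_wf Xi' (sub_skel_param s x)
  | EDirt d => dirt_wf Sigma Xi' (sub_dirt_param s d)
  | EType a Sk => vty_skel Sigma Xi' (sub_type_param s a) (sub_skel s Sk)
  | EDirtCo w D1 D2 =>
      dco_le Sigma Xi' (sub_dirt_co_param s w) (sub_dirt s D1) (sub_dirt s D2)
  | ETypeCo w A1 A2 =>
      vco_le Sigma Xi' (sub_type_co_param s w) (sub_vty s A1) (sub_vty s A2)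
  end.

Definition subst_valid (Op : choiceType) (Sigma : {fset Op})
    (Xi Xi' : ctx Op) (s : subst Op) : Prop :=
  forall e, List.In e Xi -> subst_entry_valid Sigma Xi' s e.

Local Open Scope classical_set_scope.

Record polset : Type := PolSet {
  pol_pos : set (type_param + dirt_param);
  pol_neg : set (type_param + dirt_param) }.

Definition pol0 : polset := PolSet set0 set0.
Definition pol1 (p : type_param + dirt_param) : polset := PolSet [set p] set0.
Definition polC (F : polset) : polset := PolSet (pol_neg F) (pol_pos F).
Definition polU (F G : polset) : polset :=
  PolSet (pol_pos F `|` pol_pos G) (pol_neg F `|` pol_neg G).
Definition pol_sub (F G : polset) : Prop :=
  (pol_pos F `<=` pol_pos G) /\ (pol_neg F `<=` pol_neg G).

Fixpoint fp_dirt (Op : Type) (D : dirt Op) : polset :=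
  match D with
  | DVar d => pol1 (inr d)
  | DEmpty => pol0
  | DOp _ D => fp_dirt D
  end.

Fixpoint fp_vty (Op : Type) (A : vty Op) : polset :=
  match A with
  | TVar a => pol1 (inl a)
  | TUnit => pol0
  | TArr A C => polU (polC (fp_vty A)) (fp_cty C)
  end
with fp_cty (Op : Type) (C : cty Op) : polset :=
  match C with
  | TComp A D => polU (fp_vty A) (fp_dirt D)
  end.

Record co_family (Op : Type) : Type := CoFamily {
  fam_type_param : type_param -> vco Op;
  fam_dirt_param : dirt_param -> dco Op }.

Fixpoint fam_dirt (Op : Type) (Y : co_family Op) (D : dirt Op) : dco Op :=
  match D with
  | DVar d => fam_dirt_param Y d
  | DEmpty => DCReflEmpty
  | DOp op D => DCOp op (fam_dirt Y D)
  end.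

Fixpoint fam_vty (Op : Type) (Y : co_family Op) (A : vty Op) : vco Op :=
  match A with
  | TVar a => fam_type_param Y a
  | TUnit => VCReflUnit
  | TArr A C => VCArr (fam_vty Y A) (fam_cty Y C)
  end
with fam_cty (Op : Type) (Y : co_family Op) (C : cty Op) : cco Op :=
  match C with
  | TComp A D => CComp (fam_vty Y A) (fam_dirt Y D)
  end.

(* [fam_param_le Sigma Xi' Y s1 s2 p]: Xi' |- Y(p) : s1(p) <= s2(p). *)
Definition fam_param_le (Op : choiceType) (Sigma : {fset Op}) (Xi' : ctx Op)
    (Y : co_family Op) (s1 s2 : subst Op) (p : type_param + dirt_param) : Prop :=
  match p with
  | inl a =>
      vco_le Sigma Xi' (fam_type_param Y a)
        (sub_type_param s1 a) (sub_type_param s2 a)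
  | inr d =>
      dco_le Sigma Xi' (fam_dirt_param Y d)
        (sub_dirt_param s1 d) (sub_dirt_param s2 d)
  end.

Definition declared (Op : Type) (Xi : ctx Op) (p : type_param + dirt_param) :
    Prop :=
  match p with
  | inl a => exists Sk, List.In (EType a Sk) Xi
  | inr d => List.In (EDirt d) Xi
  end.

(* Substitutions Xi => Xi' are meaningful only on the parameters of Xi, so the
   members of F outside Xi impose no condition. *)
Definition fam_le (Op : choiceType) (Sigma : {fset Op}) (Xi Xi' : ctx Op)
    (Y : co_family Op) (F : polset) (s1 s2 : subst Op) : Prop :=
  (forall p, declared Xi p -> pol_pos F p -> fam_param_le Sigma Xi' Y s1 s2 p) /\
  (forall p, declared Xi p -> pol_neg F p -> fam_param_le Sigma Xi' Y s2 s1 p).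

(* Main.v *)
(* In the contravariant case [A -> C] the induction hypothesis for [A] is used
   with the two substitutions exchanged and [F] replaced by its conjugate, so
   all three are generalized; the coercion family stays the same. *)

Require Import Defs.
From mathcomp Require Import all_boot.
From mathcomp Require Import finmap.
From mathcomp Require Import classical_sets.

Set Implicit Arguments.
Unset Strict Implicit.
Unset Printing Implicit Defensive.

(* The default principle for [vty_skel] gives no induction hypothesis for the codomain of an arrow,
   which is a computation type. *)
Scheme vty_skel_mut_ind := Minimality for vty_skel Sort Prop
  with cty_skel_mut_ind := Minimality for cty_skel Sort Prop.
Combined Scheme vty_cty_skel_ind from vty_skel_mut_ind, cty_skel_mut_ind.

Lemma pol_subU (F G H : polset) :
  pol_sub (polU F G) H -> pol_sub F H /\ pol_sub G H.
Proof. by case; rewrite /= !subUset => -[Fp Gp] [Fn Gn]. Qed.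

Lemma pol_subC (F G : polset) : pol_sub (polC F) G -> pol_sub F (polC G).
Proof. by case. Qed.

Lemma fam_leC (Op : choiceType) (Sigma : {fset Op}) (Xi Xi' : ctx Op)
    (Y : co_family Op) (F : polset) (s1 s2 : subst Op) :
  fam_le Sigma Xi Xi' Y F s1 s2 -> fam_le Sigma Xi Xi' Y (polC F) s2 s1.
Proof. by case. Qed.

(** A dirt has no contravariant position, so the positive clause of [fam_le] suffices and the
    induction on [D] keeps [F], [s1] and [s2] fixed. *)
Lemma fam_dirt_le (Op : choiceType) (Sigma : {fset Op}) (Xi Xi' : ctx Op)
    (Y : co_family Op) (F : polset) (s1 s2 : subst Op) (D : dirt Op) :
  fam_le Sigma Xi Xi' Y F s1 s2 -> dirt_wf Sigma Xi D ->
  pol_sub (fp_dirt D) F ->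
  dco_le Sigma Xi' (fam_dirt Y D) (sub_dirt s1 D) (sub_dirt s2 D).
Proof.
case=> le_Y _; elim: D => [d|_ _|op D IHD] /=.
- by move=> Xi_d [Fd _]; apply: (le_Y (inr d)) => //; apply: Fd.
- exact: dco_le_refl_empty.
- by move=> [Sigma_op D_wf] F_D; apply: dco_le_op => //; apply: IHD.
Qed.

(** Induction runs over the skeleton derivation, since its leaves supply what [fam_le] and
    [fam_dirt_le] ask for: type parameters declared in [Xi] and well-formed dirts. *)
Lemma fam_vty_cty_le (Op : choiceType) (Sigma : {fset Op}) (Xi Xi' : ctx Op)
    (Y : co_family Op) :
  (forall (A : vty Op) (Sk : skel), vty_skel Sigma Xi A Sk ->
     forall (F : polset) (s1 s2 : subst Op),
     fam_le Sigma Xi Xi' Y F s1 s2 -> pol_sub (fp_vty A) F ->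
     vco_le Sigma Xi' (fam_vty Y A) (sub_vty s1 A) (sub_vty s2 A)) /\
  (forall (C : cty Op) (Sk : skel), cty_skel Sigma Xi C Sk ->
     forall (F : polset) (s1 s2 : subst Op),
     fam_le Sigma Xi Xi' Y F s1 s2 -> pol_sub (fp_cty C) F ->
     cco_le Sigma Xi' (fam_cty Y C) (sub_cty s1 C) (sub_cty s2 C)).
Proof.
apply: vty_cty_skel_ind => /=.
- move=> a Sk Xi_a _ F s1 s2 [le_Y _] [Fa _].
  by apply: (le_Y (inl a)); [exists Sk | apply: Fa].
- by move=> *; apply: vco_le_refl_unit.
- move=> A C Sk1 Sk2 _ IHA _ IHC F s1 s2 le_Y /pol_subU[/pol_subC F_A F_C].
  apply: vco_le_arr; last exact: IHC le_Y F_C.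
  (* The domain premise of [vco_le_arr] runs from [sub_vty s2 A] to [sub_vty s1 A]; the hypothesis
     is used at [polC F], [s2], [s1]. *)
  exact: IHA (fam_leC le_Y) F_A.
- move=> A D Sk _ IHA D_wf F s1 s2 le_Y /pol_subU[F_A F_D].
  by apply: cco_le_comp; [exact: IHA le_Y F_A | exact: fam_dirt_le le_Y D_wf F_D].
Qed.

Theorem proposition4p5 (Op : choiceType) (Sigma : {fset Op}) (Xi Xi' : ctx Op)
    (s1 s2 : subst Op) (Y : co_family Op) (F : polset)
    (wfXi : ctx_wf Sigma Xi) (wfXi' : ctx_wf Sigma Xi')
    (valid_s1 : subst_valid Sigma Xi Xi' s1)
    (valid_s2 : subst_valid Sigma Xi Xi' s2)
    (le_Y : fam_le Sigma Xi Xi' Y F s1 s2) :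
  (forall (A : vty Op) (Sk : skel),
     vty_skel Sigma Xi A Sk -> pol_sub (fp_vty A) F ->
     vco_le Sigma Xi' (fam_vty Y A) (sub_vty s1 A) (sub_vty s2 A)) /\
  (forall (C : cty Op) (Sk : skel),
     cty_skel Sigma Xi C Sk -> pol_sub (fp_cty C) F ->
     cco_le Sigma Xi' (fam_cty Y C) (sub_cty s1 C) (sub_cty s2 C)).
Proof.
have [le_vty le_cty] := fam_vty_cty_le Sigma Xi Xi' Y.
split=> [A|C] Sk wf_T; first exact: le_vty wf_T _ _ _ le_Y.
exact: le_cty wf_T _ _ _ le_Y.
Qed.
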